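(* Define $h(n)$ by $$\sum_{n=0}^{\infty}h(n)q^n=\sum_{n=0}^{\infty}\frac{(-q;q)_{2n}q^n}{(q;q)_{2n+1}}=\frac{(-q;q)_\infty}{(q;q)_\infty}(q^4,-q^4,-q^4;q^4)_\infty .$$ Then $h(n)$ equals the number of partitions of $n$ into parts such that no part is $\equiv0\pmod 8$, parts $\equiv2,6\pmod 8$ have one colour, and parts $\equiv1,3,4,5,7\pmod 8$ have two colours.
   Context: $(A;q)_0=1$, $(A;q)_n=\prod_{j=0}^{n-1}(1-Aq^j)$, $(A;q)_\infty=\prod_{j\ge0}(1-Aq^j)$, and $(A_1,\dots,A_r;q)_\infty=\prod_i(A_i;q)_\infty$. A part ''having $t$ colours'' means that part may occur in $t$ distinguishable copies; the generating function for partitions where parts $\equiv r\pmod s$ have $t$ colours is $1/(q^r;q^s)_\infty^t$. *)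

(* Defs.v *)
(* Formal power series in q are handled through exact
   polynomial truncations over int: the coefficient of q^n of each series is
   computed from a polynomial that agrees with the series up to degree n. *)
From HB Require Import structures.
From mathcomp Require Import all_boot all_order all_algebra.
Set Implicit Arguments. Unset Strict Implicit. Unset Printing Implicit Defensive.
Import Order.TTheory GRing.Theory Num.Theory.
Local Open Scope ring_scope.

(* 1/(1-q^j) truncated: sum_{i=0}^{N} q^(j*i); exact up to degree N when j>=1 *)
Definition geomT (N j : nat) : {poly int} := \sum_(i < N.+1) 'X^(j * i).

Definition negqpoch (m : nat) : {poly int} := \prod_(1 <= j < m.+1) (1 + 'X^j).

(* truncation (exact up to degree N) of 1/(q;q)_m = prod_{j=1}^m 1/(1-q^j) *)
Definition invqpochT (N m : nat) : {poly int} := \prod_(1 <= j < m.+1) geomT N j.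

(* h(n): coefficient of q^n in sum_{k>=0} (-q;q)_{2k} q^k / (q;q)_{2k+1}.
   Terms with k > n are O(q^{n+1}), so the sum is truncated at k = n. *)
Definition h (n : nat) : int :=
  (\sum_(k < n.+1) negqpoch (2 * k) * 'X^k * invqpochT n (2 * k).+1)`_n.

(* coefficient of q^n in (-q;q)_oo/(q;q)_oo (q^4,-q^4,-q^4;q^4)_oo,
   all infinite products truncated at index n (exact up to degree n). *)
Definition hprod (n : nat) : int :=
  (negqpoch n * invqpochT n n *
   \prod_(1 <= j < n.+1) ((1 - 'X^(4 * j)) * (1 + 'X^(4 * j)) ^+ 2))`_n.

Definition ncolours (m : nat) : nat :=
  if (m %% 8 == 0)%N then 0%N
  else if ((m %% 8 == 2) || (m %% 8 == 6))%N then 1%N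
  else 2%N.

(* A coloured partition of n is encoded by its multiplicity function:
   f (m, c) = number of occurrences of part m with colour c.
   Parts are at most n and multiplicities at most n, so this is finite. *)
Definition coloured_partition (n : nat) (f : {ffun 'I_n.+1 * 'I_2 -> 'I_n.+1}) : bool :=
  [forall p, (f p != 0 :> nat) ==> ((0 < p.1)%N && (p.2 < ncolours p.1)%N)]
  && ((\sum_(p : 'I_n.+1 * 'I_2) (p.1 : nat) * (f p : nat))%N == n).

Definition count_coloured (n : nat) : nat :=
  #|[set f : {ffun 'I_n.+1 * 'I_2 -> 'I_n.+1} | coloured_partition f]|.

(* Main.v *)
(* Write t = q^(1/2) and F(z) = sum_N (-1;q)_N z^N / (q;q)_N.  Since
   (-1;q)_(2k+1) = 2 (-q;q)_(2k), the odd part F(t) - F(-t) is 4t times the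
   generating function of h.  The functional equation
   (1 - z) F(z) = (1 + z) F(qz) gives F(z) = (-z;q)_oo / (z;q)_oo, hence
     F(t) - F(-t) = ((-t;q)_oo^2 - (t;q)_oo^2) / (q;q^2)_oo.
   By the Jacobi triple product (q;q)_oo (-t;q)_oo^2 = sum_i t^(i^2), so the
   numerator times (q;q)_oo is 4t psi(q^4), where
   psi(q) = sum_(i >= 0) q^(i(i+1)/2) = (q;q)_oo (-q;q)_oo^2 is the triple
   product again.  Euler's (q;q^2)_oo (-q;q)_oo = 1 then yields the product.
   Power series identities are congruences modulo q^M, and the triple product
   is the limit of a finite form of the q-binomial theorem. *)
Require Import Defs.
From mathcomp Require Import all_boot all_order all_algebra.
From mathcomp Require Import zify ring.
Set Implicit Arguments. Unset Strict Implicit. Unset Printing Implicit Defensive.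
Import GRing.Theory.
Local Open Scope ring_scope.

(** * Congruences modulo an element of a commutative ring *)

Section Congruence.
Variable R : comNzRingType.
Implicit Types m x y z : R.

(** With [m = q ^+ M] this is equality up to O(q^M). Any ring element may serve as [q], so the same
    lemmas apply at ['X] and at ['X ^+ 2]. *)
Definition eqmod m x y := exists z, x - y = z * m.

Lemma eqmod_refl m x : eqmod m x x.
Proof. by exists 0; rewrite subrr mul0r. Qed.

Lemma eqmod_eq m x y : x = y -> eqmod m x y.
Proof. by move->; apply: eqmod_refl. Qed.

Lemma eqmod_sym m x y : eqmod m x y -> eqmod m y x.
Proof. by case=> z e; exists (- z); rewrite mulNr -e opprB. Qed.

Lemma eqmod_trans m y x z : eqmod m x y -> eqmod m y z -> eqmod m x z.
Proof.
by case=> u eu [v ev]; exists (u + v); rewrite mulrDl -eu -ev addrA subrK.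
Qed.

Lemma eqmodD m x y x' y' :
  eqmod m x y -> eqmod m x' y' -> eqmod m (x + x') (y + y').
Proof. by case=> u eu [v ev]; exists (u + v); rewrite mulrDl -eu -ev; ring. Qed.

Lemma eqmodN m x y : eqmod m x y -> eqmod m (- x) (- y).
Proof. by case=> u eu; exists (- u); rewrite mulNr -eu; ring. Qed.

Lemma eqmodB m x y x' y' :
  eqmod m x y -> eqmod m x' y' -> eqmod m (x - x') (y - y').
Proof. by move=> ? ?; apply: eqmodD => //; apply: eqmodN. Qed.

Lemma eqmodM m x y x' y' :
  eqmod m x y -> eqmod m x' y' -> eqmod m (x * x') (y * y').
Proof.
case=> u eu [v ev]; exists (u * x' + y * v).
have -> : (u * x' + y * v) * m = (u * m) * x' + y * (v * m) by ring.
by rewrite -eu -ev; ring.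
Qed.

Lemma eqmodMl m x y z : eqmod m x y -> eqmod m (z * x) (z * y).
Proof. by apply: eqmodM; apply: eqmod_refl. Qed.

Lemma eqmodMr m x y z : eqmod m x y -> eqmod m (x * z) (y * z).
Proof. by move=> e; apply: eqmodM => //; apply: eqmod_refl. Qed.

Lemma eqmod_sum m (I : Type) (r : seq I) (P : pred I) (F G : I -> R) :
  (forall i, P i -> eqmod m (F i) (G i)) ->
  eqmod m (\sum_(i <- r | P i) F i) (\sum_(i <- r | P i) G i).
Proof.
move=> FG; apply: (big_ind2 (eqmod m)) => //; first exact: eqmod_refl.
by move=> *; apply: eqmodD.
Qed.

Lemma eqmod_prod1 m (I : Type) (r : seq I) (P : pred I) (F : I -> R) :
  (forall i, P i -> eqmod m (F i) 1) -> eqmod m (\prod_(i <- r | P i) F i) 1.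
Proof.
move=> F1; apply: (big_ind (eqmod m ^~ 1)) => //; first exact: eqmod_refl.
by move=> x y x1 y1; rewrite -[X in eqmod _ _ X]mulr1; apply: eqmodM.
Qed.

Lemma eqmod_dvd m z x y : eqmod (z * m) x y -> eqmod m x y.
Proof. by case=> u e; exists (u * z); rewrite e mulrA. Qed.

Lemma eqmod_exp_le m (k l : nat) x y :
  (k <= l)%N -> eqmod (m ^+ l) x y -> eqmod (m ^+ k) x y.
Proof. by move=> kl; rewrite -(subnK kl) exprD; apply: eqmod_dvd. Qed.

Lemma eqmod_exp0 m (k l : nat) : (k <= l)%N -> eqmod (m ^+ k) (m ^+ l) 0.
Proof. by move=> kl; exists (m ^+ (l - k)); rewrite subr0 -exprD subnK. Qed.

(** The modulus grows with the factor: an explicit power of q in front of a term raises its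
    precision. *)
Lemma eqmod_scale m z x y : eqmod m x y -> eqmod (z * m) (z * x) (z * y).
Proof. by case=> u e; exists u; rewrite -mulrBr e; ring. Qed.

Definition invertible_mod m u := exists v, eqmod m (u * v) 1.

Lemma invertible_modM m u v :
  invertible_mod m u -> invertible_mod m v -> invertible_mod m (u * v).
Proof.
case=> u' eu [v' ev]; exists (u' * v').
have -> : u * v * (u' * v') = (u * u') * (v * v') by ring.
by rewrite -[X in eqmod _ _ X]mulr1; apply: eqmodM.
Qed.

(** As [x] is nilpotent modulo [m], the finite geometric series is an inverse. *)
Lemma invertible_mod1B m x (k : nat) :
  eqmod m (x ^+ k) 0 -> invertible_mod m (1 - x).
Proof.
move=> xk; exists (\sum_(i < k) x ^+ i); rewrite -opprB mulNr -subrX1 opprB.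
by rewrite -[X in eqmod _ _ X]subr0; apply: eqmodB => //; apply: eqmod_refl.
Qed.

Lemma eqmod_cancel m u x y :
  invertible_mod m u -> eqmod m (u * x) (u * y) -> eqmod m x y.
Proof.
case=> v uv uxy; apply: (@eqmod_trans _ (u * v * x)).
  by rewrite -[X in eqmod _ X]mul1r; apply/eqmodMr/eqmod_sym.
apply: (@eqmod_trans _ (u * v * y)); last first.
  by rewrite -[X in eqmod _ _ X]mul1r; apply/eqmodMr.
have e w : u * v * w = v * (u * w) by ring.
by rewrite !e; apply: eqmodMl.
Qed.

End Congruence.

(** * Pochhammer products and the q-binomial theorem *)

Section Pochhammer.
Variable R : comNzRingType.
Implicit Types a q x y : R.

Definition poch a q n := \prod_(i < n) (1 - a * q ^+ i).

Lemma poch0 a q : poch a q 0 = 1.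
Proof. exact: big_ord0. Qed.

Lemma pochS a q n : poch a q n.+1 = poch a q n * (1 - a * q ^+ n).
Proof. exact: big_ord_recr. Qed.

(** Each further factor [1 - a q^i], [i >= n], is 1 modulo [a q^n]. *)
Lemma poch_trunc a q n m :
  (n <= m)%N -> eqmod (a * q ^+ n) (poch a q m) (poch a q n).
Proof.
move=> nm; rewrite -(subnK nm).
elim: (m - n)%N => [|k IH]; first exact: eqmod_refl.
rewrite addSn pochS; apply: eqmod_trans IH.
exists (- poch a q (k + n) * q ^+ k); rewrite exprD; ring.
Qed.

Lemma qpoch_trunc q N n m : (N <= n.+1)%N -> (N <= m.+1)%N ->
  eqmod (q ^+ N) (poch q q n) (poch q q m).
Proof.
wlog nm : n m / (n <= m)%N => [W nN mN|nN mN].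
  case: (leqP n m) => [nm | /ltnW nm]; first exact: W.
  by apply: eqmod_sym; apply: W.
apply/eqmod_sym/(eqmod_exp_le nN); rewrite exprS; exact: poch_trunc.
Qed.

Lemma negqpoch_trunc q N n m : (N <= n.+1)%N -> (N <= m.+1)%N ->
  eqmod (q ^+ N) (poch (- q) q n) (poch (- q) q m).
Proof.
wlog nm : n m / (n <= m)%N => [W nN mN|nN mN].
  case: (leqP n m) => [nm | /ltnW nm]; first exact: W.
  by apply: eqmod_sym; apply: W.
apply/eqmod_sym/(eqmod_exp_le nN); rewrite exprS; apply: (@eqmod_dvd _ _ (-1)).
by rewrite mulrA mulN1r; exact: poch_trunc.
Qed.

Lemma qpoch_invertible q N n : invertible_mod (q ^+ N) (poch q q n).
Proof.
elim: n => [|n IH].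
  by exists 1; rewrite poch0 mulr1; apply: eqmod_refl.
rewrite pochS; apply: invertible_modM => //.
rewrite -exprS; apply: (@invertible_mod1B _ _ _ N).
by rewrite -exprM; apply: eqmod_exp0; rewrite mulSn leq_addr.
Qed.

(** The factors [1 - q^j] are sorted by the parity of [j]; this is the source of Euler's
    identity. *)
Lemma qpoch_parity q n :
  poch q q (n + n) = poch q (q ^+ 2) n * poch (q ^+ 2) (q ^+ 2) n.
Proof.
elim: n => [|n IH]; first by rewrite !poch0 mulr1.
rewrite addSn addnS !pochS IH -!exprM mul2n -addnn !exprS exprD; ring.
Qed.

Lemma poch_sq a q n : poch a q n * poch (- a) q n = poch (a ^+ 2) (q ^+ 2) n.
Proof.
rewrite /poch -big_split; apply: eq_bigr => i _ /=.
by rewrite -exprM mulnC exprM; ring.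
Qed.

Fixpoint gbin q n k :=
  match n, k with
  | 0, 0 => 1
  | 0, _.+1 => 0
  | _.+1, 0 => 1
  | n'.+1, k'.+1 => gbin q n' k' + q ^+ k * gbin q n' k
  end.

Lemma gbin0 q n : gbin q n 0 = 1.
Proof. by case: n. Qed.

Lemma gbin_small q n k : (n < k)%N -> gbin q n k = 0.
Proof.
elim: n k => [|n IH] [|k] //= nk.
by rewrite !IH ?mulr0 ?addr0 // ltnW.
Qed.

(** The quotient formula with denominators cleared. The induction rests on [1 - q^(k+l+2) = (1 -
    q^(k+1)) + q^(k+1) (1 - q^(l+1))]. *)
Lemma gbin_fact q k l :
  gbin q (k + l) k * (poch q q k * poch q q l) = poch q q (k + l).
Proof.
move e: (k + l)%N => n; elim: n k l e => [|n IH] [|k] l e //.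
- by have -> : l = 0%N by []; rewrite /= !poch0 !mul1r.
- by have -> : l = n.+1 by []; rewrite gbin0 poch0 !mul1r.
case: l e => [|l] e.
  have nk : n = k by lia.
  rewrite {}nk in IH *; rewrite poch0 mulr1 /= (@gbin_small _ k k.+1) // mulr0 addr0 pochS mulrA.
  by have := IH k 0%N; rewrite poch0 mulr1 addn0 => ->; last lia.
have e1 := IH k l.+1 ltac:(lia); have e2 := IH k.+1 l ltac:(lia).
rewrite [gbin _ _ _]/=.
have -> : (gbin q n k + q ^+ k.+1 * gbin q n k.+1) *
   (poch q q k.+1 * poch q q l.+1) =
   gbin q n k * (poch q q k * poch q q l.+1) * (1 - q * q ^+ k) +
   q ^+ k.+1 * (gbin q n k.+1 * (poch q q k.+1 * poch q q l)) * (1 - q * q ^+ l).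
  rewrite (pochS q q k) (pochS q q l); ring.
rewrite e1 e2 pochS.
have -> : n = (k + l.+1)%N by lia.
rewrite !exprS !exprD !exprS; ring.
Qed.

(** Splitting off the factor [j = 0] leaves the same product with [x q] for [x]; the q-Pascal rule
    then recombines the two sums. *)
Lemma q_binomial q x y n :
  \prod_(j < n) (y + x * q ^+ j) =
  \sum_(k < n.+1) gbin q n k * q ^+ 'C(k, 2) * x ^+ k * y ^+ (n - k).
Proof.
elim: n x => [|n IH] x; first by rewrite big_ord0 big_ord_recr big_ord0 /=; ring.
rewrite big_ord_recl expr0 mulr1.
under eq_bigr => i _ do rewrite exprS mulrA.
rewrite IH mulrDl (big_ord_recl n.+1) /= bin0n expr0 subn0 !mulr1.
rewrite big_distrr /= big_ord_recl /= gbin0 /= subn0 bin0n expr0 !mul1r -exprS.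
rewrite -addrA; congr (_ + _).
rewrite big_distrr /=.
(* The added top term vanishes by [gbin_small], so both sums run over [n.+1] indices. *)
have -> : \sum_(i < n) y * (gbin q n (bump 0 i) * q ^+ 'C(bump 0 i, 2) *
    (x * q) ^+ bump 0 i * y ^+ (n - bump 0 i)) =
  \sum_(i < n.+1) q ^+ i.+1 * gbin q n i.+1 * q ^+ 'C(i.+1, 2) *
    x ^+ i.+1 * y ^+ (n - i).
  rewrite big_ord_recr /= gbin_small // mulr0 !mul0r addr0.
  apply: eq_bigr => i _; rewrite /bump /= add1n exprMn.
  have -> : (n - i = (n - i.+1).+1)%N by have := ltn_ord i; lia.
  by rewrite (exprS y); ring.
rewrite -big_split; apply: eq_bigr => i _ /=.
rewrite /bump /= add1n subSS binS bin1 exprMn addnC exprD !exprS.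
ring.
Qed.

End Pochhammer.

Arguments gbin : simpl never.

(** * The Jacobi triple product *)

Lemma double_bin2 n : (2 * 'C(n.+1, 2) = n * n.+1)%N.
Proof. by rewrite -mul_bin_diag bin1 mulnC. Qed.

Section JacobiTriple.
Variable R : idomainType.
Implicit Types a b q t : R.

(** The coefficient is [(q;q)_(k+l) / ((q;q)_k (q;q)_l)], and all these products agree with
    [(q;q)_L] modulo [q^N]; hence it tends to [1/(q;q)_oo]. *)
Lemma gbin_limit q N L k l :
    (N <= k.+1)%N -> (N <= l.+1)%N -> (N <= L.+1)%N ->
  eqmod (q ^+ N) (poch q q L * gbin q (k + l) k) 1.
Proof.
move=> Nk Nl NL; apply: (eqmod_cancel (qpoch_invertible q N L)).
rewrite mulr1; apply: (@eqmod_trans _ _ (poch q q (k + l))); last first.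
  by apply: qpoch_trunc => //; apply: leq_trans Nk _; rewrite ltnS leq_addr.
rewrite -gbin_fact mulrA mulrC; apply/eqmodMl.
by apply: eqmodM; apply: qpoch_trunc.
Qed.

Lemma prod_expr q n : \prod_(i < n) q ^+ i = q ^+ 'C(n, 2).
Proof.
elim: n => [|n IH]; first by rewrite big_ord0 bin0n.
by rewrite big_ord_recr /= IH binS bin1 exprD.
Qed.

(* The q-binomial theorem with x = 1 and y = b q^(n-1), after removing the
   common factor q^C(n,2) (b q^(n-1))^n. *)
Lemma jacobi_finite a b n : a != 0 -> b != 0 ->
  let q := a * b in
  poch (- a) q n * poch (- b) q n =
  gbin q (n + n) n +
  \sum_(i < n) (gbin q (n + n) (n + i.+1) * (a ^+ 'C(i.+2, 2) * b ^+ 'C(i.+1, 2))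
    + gbin q (n + n) (n - i.+1) * (a ^+ 'C(i.+1, 2) * b ^+ 'C(i.+2, 2))).
Proof.
move=> a0 b0 q; case: n => [|p]; first by rewrite !poch0 big_ord0 /= addr0 mulr1.
set n := p.+1.
pose c := q ^+ 'C(n, 2) * (b * q ^+ p) ^+ n.
have q0 : q != 0 by rewrite mulf_neq0.
have c0 : c != 0 by rewrite !(mulf_neq0, expf_neq0).
apply: (mulfI c0).
have -> : c * (poch (- a) q n * poch (- b) q n) =
    \prod_(j < n + n) (b * q ^+ p + 1 * q ^+ j).
  (* For [j < n] the factor is [q^j (1 + b q^(n-1-j))]; for [j = n + i], [q = a b] turns it into
     [b q^p (1 + a q^i)]. *)
  rewrite big_split_ord /=.
  have -> : \prod_(i < n) (b * q ^+ p + 1 * q ^+ i) = q ^+ 'C(n, 2) * poch (- b) q n.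
    have -> : poch (- b) q n = \prod_(i < n) (1 - - b * q ^+ (n - i.+1)).
      by rewrite /poch (reindex_inj rev_ord_inj).
    rewrite -prod_expr -big_split /=.
    apply: eq_bigr => i _.
    have -> : p = (i + (n - i.+1))%N by have := ltn_ord i; lia.
    by rewrite exprD; ring.
  have -> : \prod_(i < n) (b * q ^+ p + 1 * q ^+ (n + i)) =
      (b * q ^+ p) ^+ n * poch (- a) q n.
    have -> : (b * q ^+ p) ^+ n = \prod_(i < n) (b * q ^+ p).
      by rewrite prodr_const card_ord.
    rewrite -big_split.
    by apply: eq_bigr => i _ /=; rewrite /n addSn exprS exprD /q; ring.
  by rewrite /c; ring.
(* Monomials are compared through their exponents of [a] and of [b] separately. *)
have mono u v x y z w k :
    (u + p * v = 'C(n, 2) + p * n + x)%N ->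
    (u + (v + p * v) = 'C(n, 2) + (n + p * n) + y)%N -> k = v ->
    gbin q z w * q ^+ u * 1 ^+ w * (b * q ^+ p) ^+ k =
    c * (gbin q z w * (a ^+ x * b ^+ y)).
  move=> eA eB ->; rewrite expr1n mulr1 /c -mulrA.
  rewrite [RHS]mulrCA; congr (_ * _).
  rewrite /q !exprMn -!exprM.
  transitivity (a ^+ (u + p * v) * b ^+ (u + (v + p * v))).
    by rewrite !exprD; ring.
  by rewrite eA eB !exprD; ring.
(* The sum is cut at its central index [n]; the lower half, reversed, is then paired with the upper
   half. *)
rewrite q_binomial -addnS big_split_ord /= (big_ord_recl n) /= addn0 mulrDr addrCA.
congr (_ + _).
  rewrite (mono _ n 0 0)%N; [by rewrite !mulr1 | | |]; lia.
rewrite addrC big_distrr /= [X in _ + X](reindex_inj rev_ord_inj) -big_split.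
apply: eq_bigr => -[i ilt] _ /=; rewrite mulrDr /bump /= add1n.
have [j pij] : exists j, p = (i + j)%N.
  by exists (p - i)%N; move: ilt; rewrite /n; lia.
have e1 := double_bin2 i.+1; have e2 := double_bin2 i.
have e3 := double_bin2 p.
congr (_ + _).
  apply: (mono _ j); rewrite /n.
  - have := double_bin2 (p + i.+1); rewrite addSn pij in e3 *; nia.
  - have := double_bin2 (p + i.+1); rewrite addSn pij in e3 *; nia.
  by rewrite addSn; lia.
apply: (mono _ (p + i.+2)%N); rewrite /n.
- have -> : (p.+1 - i.+1 = j)%N by lia.
  case: j pij => [|j] pij; last have := double_bin2 j; rewrite ?bin0n;
  rewrite pij in e3 *; nia.
- have -> : (p.+1 - i.+1 = j)%N by lia.
  case: j pij => [|j] pij; last have := double_bin2 j; rewrite ?bin0n;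
  rewrite pij in e3 *; nia.
by lia.
Qed.

(** The right side truncates Ramanujan's theta function, the sum over all integers k of
    [a^(k(k+1)/2) b^(k(k-1)/2)], with [k] and [-k] paired. *)
Lemma jacobi_limit a b n L : a != 0 -> b != 0 -> (n <= L)%N ->
  let q := a * b in
  eqmod (q ^+ n) (poch q q L * (poch (- a) q n * poch (- b) q n))
    (1 + \sum_(i < n) (a ^+ 'C(i.+2, 2) * b ^+ 'C(i.+1, 2) +
                       a ^+ 'C(i.+1, 2) * b ^+ 'C(i.+2, 2))).
Proof.
move=> a0 b0 nL q; rewrite jacobi_finite // mulrDr big_distrr /=.
apply: eqmodD; first by apply: gbin_limit; lia.
apply: eqmod_sum => i _; rewrite mulrDr -/q.
(* At distance [i.+1] from the centre the Gaussian binomial is known only modulo [q^(n-i)]. The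
   factor [q^C(i+1,2)] of the term makes up the loss, as [C(i+1,2) >= i]. *)
have lim k x y (z : R) : (k <= n + n)%N -> (n - i <= k.+1)%N ->
    (n - i <= (n + n - k).+1)%N -> x * y = q ^+ 'C(i.+1, 2) * z ->
    eqmod (q ^+ n) (poch q q L * (gbin q (n + n) k * (x * y))) (x * y).
  move=> k1 k2 k3 ->.
  apply: (@eqmod_exp_le _ _ _ ('C(i.+1, 2) + (n - i))).
    by have := ltn_ord i; have := double_bin2 i; nia.
  rewrite exprD.
  have -> : poch q q L * (gbin q (n + n) k * (q ^+ 'C(i.+1, 2) * z)) =
     q ^+ 'C(i.+1, 2) * (poch q q L * gbin q (n + n) k * z) by ring.
  apply: eqmod_scale; rewrite -[X in eqmod _ _ X]mul1r; apply: eqmodMr.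
  have {1}-> : (n + n = k + (n + n - k))%N by lia.
  by apply: gbin_limit; lia.
have := ltn_ord i => ilt.
apply: eqmodD.
  apply: (lim _ _ _ (a ^+ i.+1)); try lia.
  by rewrite (binS i.+1) bin1 exprD /q exprMn; ring.
apply: (lim _ _ _ (b ^+ i.+1)); try lia.
by rewrite (binS i.+1) bin1 exprD /q exprMn; ring.
Qed.

(** The triple product at [a = 1], [b = q]: both halves of the theta sum are the triangular series,
    and [(-1;q)_n = 2 (-q;q)_(n-1)]. The 2 stays, as it may be zero in [R]. *)
Lemma gauss_triangular q n : q != 0 ->
  eqmod (q ^+ n) (2%:R * (poch q q n * poch (- q) q n ^+ 2))
    (2%:R * \sum_(i < n) q ^+ 'C(i.+1, 2)).
Proof.
move=> q0; have := @jacobi_limit 1 q n n (oner_neq0 _) q0 (leqnn n).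
rewrite /= mul1r => J; apply: eqmod_trans (eqmod_trans J _).
  case: n {J} => [|n]; first by exists (2 * (poch q q 0 * poch (- q) q 0 ^+ 2) - poch q q 0 * (poch (-1) q 0 * poch (- q) q 0)); rewrite expr0 mulr1.
  have -> : poch (-1) q n.+1 = 2%:R * poch (- q) q n.
    rewrite /poch big_ord_recl expr0; congr (_ * _); first by ring.
    by apply: eq_bigr => i _; rewrite /= /bump /= add1n exprS; ring.
  apply: eqmod_trans (_ : eqmod _ (2%:R * (poch q q n.+1 * (poch (- q) q n * poch (- q) q n.+1))) _); last first.
    by apply: eqmod_eq; ring.
  rewrite expr2; do !apply: eqmodMl; apply: eqmodMr.
  by apply: negqpoch_trunc.
rewrite big_split /= addrCA.
under eq_bigr => i _ do rewrite expr1n mul1r.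
under [X in _ + (_ + X)]eq_bigr => i _ do rewrite expr1n mul1r.
have -> : 2%:R * \sum_(i < n) q ^+ 'C(i.+1, 2) =
  \sum_(i < n) q ^+ 'C(i.+1, 2) + \sum_(i < n) q ^+ 'C(i.+1, 2) by ring.
apply: eqmodD; first exact: eqmod_refl.
have -> : 1 + \sum_(i < n) q ^+ 'C(i.+2, 2) = \sum_(i < n.+1) q ^+ 'C(i.+1, 2).
  by rewrite big_ord_recl.
(* The surplus term has exponent [C(n+1,2) >= n]. *)
rewrite big_ord_recr /= -[X in eqmod _ _ X]addr0.
apply: eqmodD; first exact: eqmod_refl.
by apply: eqmod_exp0; have := double_bin2 n; nia.
Qed.

(** The triple product at [a = b = t] and at [a = b = -t]. Even squares cancel, and
    [t^((2s+1)^2) = t (q^4)^C(s+1,2)]. One 2 comes from pairing [k] with [-k], the other from the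
    subtraction. *)
Lemma theta_difference t M (q := t ^+ 2) : t != 0 ->
  eqmod (q ^+ (M + M))
    (poch q q (M + M) * (poch (- t) q (M + M) ^+ 2 - poch t q (M + M) ^+ 2))
    (4%:R * t * \sum_(s < M) (q ^+ 4) ^+ 'C(s.+1, 2)).
Proof.
move=> t0; set n := (M + M)%N.
have J1 := jacobi_limit t0 t0 (leqnn n).
have nt0 : - t != 0 by rewrite oppr_eq0.
have J2 := jacobi_limit nt0 nt0 (leqnn n).
have eq1 : t * t = q by [].
have eq2 : - t * - t = q by rewrite mulrNN.
rewrite /= eq1 eq2 opprK in J1 J2.
rewrite mulrBr !expr2; apply: eqmod_trans (eqmodB J1 J2) (eqmod_eq _ _).
rewrite opprD addrACA subrr add0r -sumrB /n big_distrr /= {J1 J2}.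
(* Each step adds two terms: one odd square, which survives, and one even square, which cancels. *)
elim: M {n} => [|M IH]; first by rewrite !big_ord0.
rewrite addSn addnS 3!big_ord_recr /= IH -addrA; congr (_ + _).
have e k : ('C(k.+2, 2) + 'C(k.+1, 2) = k.+1 * k.+1)%N.
  by have := double_bin2 k; have := double_bin2 k.+1; nia.
have e' k : ('C(k.+1, 2) + 'C(k.+2, 2) = k.+1 * k.+1)%N by rewrite addnC.
rewrite -!exprD !e !e' -!mulr2n.
have s1 (k : nat) : (- t) ^+ ((M + M).+1 * (M + M).+1) = - t ^+ ((M + M).+1 * (M + M).+1).
  by rewrite exprNn -signr_odd oddM /= oddD addbb /= expr1 mulN1r.
have s2 : (- t) ^+ ((M + M).+2 * (M + M).+2) = t ^+ ((M + M).+2 * (M + M).+2).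
  by rewrite exprNn -signr_odd oddM /= oddD addbb /= expr0 mul1r.
rewrite s1 // s2 subrr addr0 /q -!exprM -mulrA -exprS.
have -> : ((M + M).+1 * (M + M).+1 = (2 * (4 * 'C(M.+1, 2))).+1)%N.
  by have := double_bin2 M; nia.
by ring.
Qed.

End JacobiTriple.

(** * The odd part of the q-binomial series *)

Section InverseProducts.
Variable R : comNzRingType.
Implicit Types a q t z : R.

(** [geomT] at a general [q]; the [M] terms correspond to [N.+1] there. *)
Definition geom q M j := \sum_(i < M) q ^+ (j * i).

Definition invqpoch q M m := \prod_(1 <= j < m.+1) geom q M j.

Lemma geomP q M j : (0 < j)%N -> eqmod (q ^+ M) ((1 - q ^+ j) * geom q M j) 1.
Proof.
move=> j0; rewrite /geom; under eq_bigr => i _ do rewrite exprM.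
rewrite -opprB mulNr -subrX1 opprB -[X in eqmod _ _ X]subr0.
apply: eqmodB; first exact: eqmod_refl.
by rewrite -exprM; apply: eqmod_exp0; rewrite leq_pmull.
Qed.

Lemma invqpoch0 q M : invqpoch q M 0 = 1.
Proof. by rewrite /invqpoch big_nil. Qed.

Lemma invqpochS q M m : invqpoch q M m.+1 = invqpoch q M m * geom q M m.+1.
Proof. by rewrite /invqpoch big_nat_recr. Qed.

Lemma invqpochP q M m : eqmod (q ^+ M) (poch q q m * invqpoch q M m) 1.
Proof.
elim: m => [|m IH]; first by rewrite poch0 invqpoch0 mulr1; apply: eqmod_refl.
rewrite pochS invqpochS mulrACA -[X in eqmod _ _ X]mulr1 -exprS.
by apply: eqmodM => //; apply: geomP.
Qed.

(* (-1;q)_N / (q;q)_N, which is 2 (-q;q)_(N-1) / (q;q)_N for N > 0. *)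
Definition bincoef q M N := poch (- 1) q N * invqpoch q M N.

(** F(z) truncated. The precision [M] of the coefficients and the number [K] of terms are separate,
    since at [z = t] about [2 M] terms are needed to reach [q^M]. *)
Definition binser q M K z := \sum_(N < K) bincoef q M N * z ^+ N.

Lemma bincoefS q M N :
  eqmod (q ^+ M) (bincoef q M N.+1 * (1 - q ^+ N.+1))
    (bincoef q M N * (1 + q ^+ N)).
Proof.
rewrite /bincoef pochS invqpochS.
have -> : poch (-1) q N * (1 - -1 * q ^+ N) *
    (invqpoch q M N * geom q M N.+1) * (1 - q ^+ N.+1) =
  (poch (-1) q N * invqpoch q M N * (1 + q ^+ N)) *
    ((1 - q ^+ N.+1) * geom q M N.+1) by ring.
by rewrite -[X in eqmod _ _ X]mulr1; apply/eqmodMl/geomP.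
Qed.

(** The coefficient recurrence [bincoefS] gives [F(z) - F(qz) = z (F(z) + F(qz))], a rearrangement
    of the claim. The hypothesis removes the term of degree [K.+1] caused by truncation. *)
Lemma binser_shift q M K z : eqmod (q ^+ M) (z ^+ K.+1) 0 ->
  eqmod (q ^+ M) ((1 - z) * binser q M K.+1 z)
    ((1 + z) * binser q M K.+1 (z * q)).
Proof.
move=> zK; set F := binser _ _ _ z; set G := binser _ _ _ _.
have dFG : eqmod (q ^+ M) (F - G) (z * (F + G)).
  have -> : F - G = \sum_(N < K) bincoef q M N.+1 * (1 - q ^+ N.+1) * z ^+ N.+1.
    rewrite /F /G /binser -sumrB big_ord_recl /= !expr0 subrr add0r.
    by apply: eq_bigr => i _; rewrite /bump /= add1n exprMn; ring.
  have -> : z * (F + G) =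
      \sum_(N < K) bincoef q M N * (1 + q ^+ N) * z ^+ N.+1 +
      bincoef q M K * (1 + q ^+ K) * z ^+ K.+1.
    rewrite /F /G /binser -big_split big_ord_recr /= mulrDr big_distrr /=.
    congr (_ + _); last by rewrite exprMn exprS; ring.
    by apply: eq_bigr => i _; rewrite exprMn exprS; ring.
  rewrite -[X in eqmod _ X]addr0; apply: eqmodD.
    by apply: eqmod_sum => i _; apply/eqmodMr/bincoefS.
  rewrite -[X in eqmod _ X](mulr0 (bincoef q M K * (1 + q ^+ K))).
  exact/eqmodMl/eqmod_sym.
have -> : (1 - z) * F = (F - G) + (G - z * F) by ring.
have -> : (1 + z) * G = z * (F + G) + (G - z * F) by ring.
by apply: eqmodD => //; apply: eqmod_refl.
Qed.

Lemma binser_shiftn q M K z J : eqmod (q ^+ M) (z ^+ K.+1) 0 ->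
  eqmod (q ^+ M) (poch z q J * binser q M K.+1 z)
    (poch (- z) q J * binser q M K.+1 (z * q ^+ J)).
Proof.
move=> zK; elim: J => [|J IH].
  by rewrite !poch0 expr0 mulr1; apply: eqmod_refl.
have zJ : eqmod (q ^+ M) ((z * q ^+ J) ^+ K.+1) 0.
  by rewrite exprMn mulrC -(mulr0 ((q ^+ J) ^+ K.+1)); apply: eqmodMl.
rewrite !pochS mulrAC; apply: eqmod_trans (eqmodMr _ IH) _.
rewrite mulrAC -!mulrA; apply: eqmodMl.
rewrite mulNr opprK exprSr mulrA; exact: binser_shift.
Qed.

(** After [J >= M] shifts the argument [t q^J] is 0 modulo [q^M], so only the constant term 1
    remains. *)
Lemma binser_product q M K t J : (M <= J)%N -> eqmod (q ^+ M) (t ^+ K.+1) 0 ->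
  eqmod (q ^+ M) (poch t q J * binser q M K.+1 t) (poch (- t) q J).
Proof.
move=> MJ tK; apply: eqmod_trans (binser_shiftn J tK) _.
rewrite -[X in eqmod _ _ X]mulr1; apply: eqmodMl.
rewrite /binser big_ord_recl expr0 mulr1 /bincoef poch0 invqpoch0 mulr1.
rewrite -[X in eqmod _ _ X]addr0; apply: eqmodD; first exact: eqmod_refl.
apply: eqmod_trans (_ : eqmod _ (\sum_(i < K) 0) _); last first.
  by rewrite big1_eq; apply: eqmod_refl.
apply: eqmod_sum => i _; rewrite /= /bump /= add1n (exprSr (t * _)).
set c := _ * invqpoch _ _ _; set u := (t * _) ^+ i.
rewrite -[X in eqmod _ _ X](mulr0 (c * u * t)) !mulrA.
exact/eqmodMl/eqmod_exp0.
Qed.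

Definition hsum q M :=
  \sum_(k < M) poch (- q) q (2 * k) * q ^+ k * invqpoch q M (2 * k).+1.

(** An exact identity: terms are taken in pairs [2k], [2k+1], and [t^(2k+1) = t q^k]. *)
Lemma binser_odd t M (q := t ^+ 2) :
  binser q M (M + M) t - binser q M (M + M) (- t) = 4%:R * t * hsum q M.
Proof.
rewrite /binser /hsum -sumrB big_distrr /=.
suff H k : \sum_(i < k + k)
     (bincoef q M i * t ^+ i - bincoef q M i * (- t) ^+ i) =
   \sum_(i < k) 4%:R * t *
     (poch (- q) q (2 * i) * q ^+ i * invqpoch q M (2 * i).+1); first exact: H.
elim: k => [|k IH]; first by rewrite !big_ord0.
rewrite addSn addnS 3!big_ord_recr /= IH -addrA; congr (_ + _).
have e N : (- t) ^+ N = (-1) ^+ odd N * t ^+ N by rewrite signr_odd -exprNn.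
rewrite !e /= oddD addbb expr0 expr1 mul1r subrr add0r /bincoef.
have -> : poch (-1) q (k + k).+1 = 2%:R * poch (- q) q (2 * k).
  rewrite /poch big_ord_recl expr0 mul2n addnn; congr (_ * _); first by ring.
  by apply: eq_bigr => i _; rewrite /= /bump /= add1n exprS; ring.
by rewrite addnn -mul2n exprS exprM /q; ring.
Qed.

Definition hproduct q n := poch (- q) q n * invqpoch q n.+1 n *
  \prod_(1 <= j < n.+1) ((1 - q ^+ (4 * j)) * (1 + q ^+ (4 * j)) ^+ 2).

Lemma psi_productE q n :
  \prod_(1 <= j < n.+1) ((1 - q ^+ (4 * j)) * (1 + q ^+ (4 * j)) ^+ 2) =
  poch (q ^+ 4) (q ^+ 4) n * poch (- q ^+ 4) (q ^+ 4) n ^+ 2.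
Proof.
rewrite big_add1 big_mkord expr2 /poch -!big_split; apply: eq_bigr => i _ /=.
by rewrite exprM exprS; ring.
Qed.

(** Clears the denominator [(q;q)_n] and aligns the product lengths [n], [M] and [L], all long
    enough for precision [q^M]. *)
Lemma hproduct_mul q n (M := n.+1) (E := poch (q ^+ 4) (q ^+ 4) M)
    (N := poch (- q ^+ 4) (q ^+ 4) M) L : (n <= L)%N ->
  eqmod (q ^+ M) (poch q q L * hproduct q n) (poch (- q) q L * (E * N ^+ 2)).
Proof.
move=> nL; rewrite /hproduct psi_productE.
set V := poch _ _ n ^+ 2; rewrite mulrA [X in X * _]mulrCA -mulrA.
have nM : (M <= n.+1)%N by [].
have q4 x y : eqmod ((q ^+ 4) ^+ M) x y -> eqmod (q ^+ M) x y.
  by rewrite -exprM; apply: eqmod_exp_le; rewrite leq_pmull.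
apply: eqmodM; first by apply: negqpoch_trunc; rewrite ltnS.
rewrite -[X in eqmod _ _ X]mul1r; apply: eqmodM.
  apply: eqmod_trans (invqpochP q M n); apply: eqmodMr.
  by apply: qpoch_trunc; rewrite ltnS.
apply: eqmodM; first by apply/q4/qpoch_trunc.
by rewrite /V !expr2; apply: eqmodM; apply/q4/negqpoch_trunc.
Qed.

End InverseProducts.

(** * The sum side against the product side *)

Section SumProduct.
Variable R : idomainType.

Lemma hsum_theta (t : R) n (M := n.+1) (q := t ^+ 2) (L := (M + M)%N) : t != 0 ->
  eqmod (q ^+ M)
    (4%:R * t * (hsum q M * (poch q (q ^+ 2) L * poch q q L)))
    (4%:R * t * (poch (q ^+ 4) (q ^+ 4) M * poch (- q ^+ 4) (q ^+ 4) M ^+ 2)).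
Proof.
move=> t0; set U := poch q q L; set V := _ * _ ^+ 2.
have tL : eqmod (q ^+ M) (t ^+ (n + M).+1) 0.
  by rewrite /q -exprM; apply: eqmod_exp0; rewrite /M; lia.
have ML : (M <= L)%N by exact: leq_addr.
have tL' : eqmod (q ^+ M) ((- t) ^+ (n + M).+1) 0.
  by rewrite exprNn -(mulr0 ((-1) ^+ (n + M).+1)); apply: eqmodMl.
have B1 := binser_product ML tL; have B2 := binser_product ML tL'.
rewrite opprK in B2.
set F := binser _ _ _ _ in B1; set G := binser _ _ _ _ in B2.
set P := poch (- t) q L in B1 B2; set Q := poch t q L in B1 B2.
(* Since [(q;q^2)_L = P * Q], multiplying by it clears the denominators of F(t) and F(-t)
   together. *)
have -> : 4%:R * t * (hsum q M * (poch q (q ^+ 2) L * U)) =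
    U * (P * (Q * F) - Q * (P * G)).
  rewrite -poch_sq -/P -/Q.
  have -> : 4%:R * t * (hsum q M * (Q * P * U)) = (4%:R * t * hsum q M) * Q * P * U by ring.
  by rewrite -binser_odd -/F -/G; ring.
apply: eqmod_trans (_ : eqmod _ (U * (P ^+ 2 - Q ^+ 2)) _).
  by rewrite !expr2; apply/eqmodMl/eqmodB; apply: eqmodMl.
apply: eqmod_trans (eqmod_exp_le ML (theta_difference M t0)) _.
have -> (x : R) : 4%:R * t * x = (2%:R * t) * (2%:R * x) by ring.
have -> : 4%:R * t * V = (2%:R * t) * (2%:R * V) by ring.
apply: eqmodMl; apply: eqmod_sym.
have q40 : q ^+ 4 != 0 by rewrite !expf_neq0.
have := gauss_triangular M q40; rewrite -exprM; apply: eqmod_exp_le.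
by rewrite leq_pmull.
Qed.

End SumProduct.

(** * Compatibility with ring morphisms, for the substitution of X^2 for X *)

Section Rmorphism.
Variables (R S : comNzRingType) (f : {rmorphism R -> S}).

Lemma rmorph_poch a q n : f (poch a q n) = poch (f a) (f q) n.
Proof.
by rewrite rmorph_prod; apply: eq_bigr => i _; rewrite rmorphB rmorph1 rmorphM rmorphXn.
Qed.

Lemma rmorph_invqpoch q M m : f (invqpoch q M m) = invqpoch (f q) M m.
Proof.
rewrite rmorph_prod; apply: eq_bigr => i _; rewrite rmorph_sum.
by apply: eq_bigr => j _; rewrite rmorphXn.
Qed.

Lemma rmorph_hsum q M : f (hsum q M) = hsum (f q) M.
Proof.
rewrite rmorph_sum; apply: eq_bigr => i _.
by rewrite !rmorphM rmorph_poch rmorphN rmorphXn rmorph_invqpoch.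
Qed.

Lemma rmorph_hproduct q n : f (hproduct q n) = hproduct (f q) n.
Proof.
rewrite /hproduct !psi_productE !expr2 !rmorphM !rmorph_poch rmorph_invqpoch.
by rewrite !rmorphN !rmorphXn.
Qed.

End Rmorphism.

(** * Equality of the coefficients of sum and product *)

Lemma eqmod_coefP (R : comNzRingType) k (p r : {poly R}) :
  eqmod 'X^k p r <-> forall i, (i < k)%N -> p`_i = r`_i.
Proof.
split=> [[z e] i ik|e].
  by apply/eqP; rewrite -subr_eq0 -coefB e coefMXn ik.
exists (drop_poly k (p - r)); rewrite -[LHS](poly_take_drop k) -[RHS]add0r.
congr (_ + _); apply/polyP => i; rewrite coef_take_poly coef0 coefB.
by case: ltnP => // ik; rewrite e // subrr.
Qed.

Lemma negqpochE m : negqpoch m = poch (- 'X) 'X m.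
Proof.
rewrite /negqpoch big_add1 big_mkord; apply: eq_bigr => i _.
by rewrite exprS; ring.
Qed.

Lemma invqpochTE n m : invqpochT n m = invqpoch 'X n.+1 m.
Proof. by []. Qed.

Lemma hE n : h n = (hsum 'X n.+1 : {poly int})`_n.
Proof.
rewrite /h /hsum; under eq_bigr => k _ do rewrite negqpochE invqpochTE.
by [].
Qed.

Lemma hprodE n : hprod n = (hproduct 'X n : {poly int})`_n.
Proof. by rewrite /hprod negqpochE. Qed.

(* The argument needs a square root t of q, so it is run at q = X^2, t = X. *)
Lemma coef_hsum_hproduct n (P := @hsum {poly int} 'X n.+1) :
  P`_n = (hproduct 'X n)`_n.
Proof.
set M := n.+1; pose q : {poly int} := 'X ^+ 2; pose L := (M + M)%N.
pose V := poch (q ^+ 4) (q ^+ 4) M * poch (- q ^+ 4) (q ^+ 4) M ^+ 2.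
pose O := poch q (q ^+ 2) L; pose U := poch q q L; pose N := poch (- q) q L.
have qMX : q ^+ M = 'X * 'X ^+ (n + M) by rewrite -exprM -exprS /M; congr (_ ^+ _); lia.
(* Cancelling [t = 'X] costs one degree; modulo ['X^(2n+1)] the coefficient of index [2n] is still
   determined. *)
have down x y : eqmod (q ^+ M) x y -> eqmod 'X^(n + M) x y.
  by rewrite qMX; apply: eqmod_dvd.
have HV : eqmod 'X^(n + M) (hsum q M * (O * U)) V.
  have X0 : 'X != 0 :> {poly int} by rewrite polyX_eq0.
  have [z] := hsum_theta n X0.
  rewrite -/q -/M -/L -/O -/U -/V -mulrBr qMX => e.
  apply/eqmod_coefP => i iM; apply/eqP; rewrite -subr_eq0 -coefB.
  have {}e : 4%:R * (hsum q M * (O * U) - V) = z * 'X ^+ (n + M).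
    apply: (mulfI X0); transitivity (z * ('X * 'X ^+ (n + M))); last by ring.
    by rewrite -e; ring.
  have : (4%:R * (hsum q M * (O * U) - V))`_i = 0 by rewrite e coefMXn iM.
  (* The factor 4 is cancelled coefficientwise over the integers. *)
  by rewrite mulr_natl coefMn => /eqP; rewrite Num.Theory.mulrn_eq0.
(* Euler's identity multiplied by [U]: the left side is exactly [(q;q)_(2L)]. *)
have NO : eqmod (q ^+ M) (N * (O * U)) U.
  have -> : N * (O * U) = poch q q (L + L).
    by rewrite qpoch_parity -/O -[q in RHS]/q -(poch_sq q q L) -/U -/N; ring.
  by apply: qpoch_trunc; rewrite /L; lia.
have e : eqmod 'X^(n + M) (hsum q M) (hproduct q n).
  have Uinv : invertible_mod 'X^(n + M) U.
    by have [v uv] := qpoch_invertible q M L; exists v; apply: down.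
  apply: (eqmod_cancel Uinv).
  apply: eqmod_trans (_ : eqmod _ (N * (O * U) * hsum q M) _).
    by apply/eqmodMr/down/eqmod_sym.
  have -> : N * (O * U) * hsum q M = N * (hsum q M * (O * U)) by ring.
  apply: eqmod_trans (eqmodMl _ HV) _; apply/down/eqmod_sym.
  by apply: hproduct_mul; rewrite /L; lia.
have comp (p : {poly int}) : p`_n = (p \Po 'X^2)`_(2 * n).
  by rewrite coef_comp_poly_Xn // dvdn_mulr // mulKn.
rewrite !comp.
have -> : P \Po 'X^2 = hsum q M by rewrite /P rmorph_hsum /= comp_polyX.
rewrite rmorph_hproduct /= comp_polyX.
by move/eqmod_coefP: e; apply; rewrite /M; lia.
Qed.

(** * Coloured partitions *)

Section ColouredProduct.
Variable R : comNzRingType.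
Implicit Types q : R.

Lemma prod_multiples (F : nat -> R) d n : (0 < d)%N ->
  \prod_(1 <= m < (d * n).+1) F m ^+ (d %| m) = \prod_(i < n) F (d * i.+1)%N.
Proof.
case: d => // d _; elim: n => [|n IH]; first by rewrite muln0 big_nil big_ord0.
rewrite (@big_cat_nat _ _ _ (d.+1 * n).+1) ?ltnS ?leq_mul //=.
rewrite IH big_ord_recr /=; congr (_ * _).
have e : (d.+1 * n.+1 = (d.+1 * n + d).+1)%N by lia.
rewrite {1}e big_nat_recr /=; last by rewrite ltnS leq_addr.
rewrite -e dvdn_mulr // expr1 big_nat big1 ?mul1r // => m /andP[m1 m2].
case: dvdnP => // -[k mk].
have : (d.+1 * n < d.+1 * k < d.+1 * n.+1)%N by lia.
by rewrite !ltn_pmul2l //; lia.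
Qed.

(** Writing the product over all [m] with exponent [d %| m] lets products for different [d] be
    compared factor by factor; factors with [m > n] are 1 at this precision. *)
Lemma prod_multiples_poch q d n : (0 < d)%N ->
  eqmod (q ^+ n.+1) (\prod_(1 <= m < n.+1) (1 - q ^+ m) ^+ (d %| m))
    (poch (q ^+ d) (q ^+ d) n).
Proof.
move=> d0.
have -> : poch (q ^+ d) (q ^+ d) n =
    \prod_(1 <= m < (d * n).+1) (1 - q ^+ m) ^+ (d %| m).
  by rewrite prod_multiples //; apply: eq_bigr => i _; rewrite exprM exprS.
rewrite [X in eqmod _ _ X](@big_cat_nat _ _ _ n.+1) ?ltnS ?leq_pmull //=.
rewrite -[X in eqmod _ X]mulr1; apply: eqmodMl; apply: eqmod_sym.
rewrite big_nat; apply: eqmod_prod1 => m /andP[nm _]; case: (_ %| _)%N; last exact: eqmod_refl.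
rewrite expr1 -[X in eqmod _ _ X]subr0.
by apply: eqmodB; [apply: eqmod_refl | apply: eqmod_exp0].
Qed.

(* The exponent of 1 - q^m in (q;q)^2 (q^4;q^4) / ((q^2;q^2) (q^8;q^8)^2). *)
Lemma ncolours_dvd m :
  (ncolours m + (2 %| m) + (8 %| m) * 2 = 2 + (4 %| m))%N.
Proof.
rewrite /ncolours; have := ltn_pmod m (isT : 0 < 8)%N.
rewrite /dvdn -(@modn_dvdm 8 m 2) // -(@modn_dvdm 8 m 4) //.
by move: (m %% 8)%N; do 8!case=> //.
Qed.

(** [W] inverts the right side, so it suffices that [W] inverts [hproduct] too. This is checked
    after multiplying by [B 2 * B 8 ^+ 2], using [B d * N d = B (2d)] for [d = 1, 4]. *)
Lemma hproduct_colours q n :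
  eqmod (q ^+ n.+1) (hproduct q n)
    (\prod_(1 <= m < n.+1) geom q n.+1 m ^+ ncolours m).
Proof.
set G := \prod_(_ <= m < _) _; set M := n.+1.
pose W := \prod_(1 <= m < n.+1) (1 - q ^+ m) ^+ ncolours m.
pose E d := \prod_(1 <= m < n.+1) (1 - q ^+ m) ^+ (d %| m).
have WG : eqmod (q ^+ M) (W * G) 1.
  rewrite /W /G -big_split big_nat /=.
  apply: eqmod_prod1 => m /andP[m0 _]; rewrite -exprMn.
  elim: (ncolours m) => [|k IH]; first exact: eqmod_refl.
  by rewrite exprS -[X in eqmod _ _ X]mulr1; apply: eqmodM => //; apply: geomP.
pose B d := poch (q ^+ d) (q ^+ d) n.
have EB d : (0 < d)%N -> eqmod (q ^+ M) (E d) (B d) by exact: prod_multiples_poch.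
have Einv d : (0 < d)%N -> invertible_mod (q ^+ M) (B d).
  move=> d0; have [v uv] := qpoch_invertible (q ^+ d) M n; exists v.
  by move: uv; rewrite -exprM; apply: eqmod_exp_le; rewrite leq_pmull.
have WE : W * E 2 * E 8 ^+ 2 = E 1 ^+ 2 * E 4.
  rewrite !expr2 /W /E -!big_split; apply: eq_bigr => m _ /=.
  by rewrite -!exprD dvd1n; congr (_ ^+ _); have := ncolours_dvd m; lia.
have WB : eqmod (q ^+ M) (W * B 2 * B 8 ^+ 2) (B 1 ^+ 2 * B 4).
  apply: eqmod_trans (_ : eqmod _ (W * E 2 * E 8 ^+ 2) _).
    rewrite !expr2; apply: eqmodM; first apply: eqmodMl.
      exact/eqmod_sym/EB.
    by apply: eqmodM; apply/eqmod_sym/EB.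
  by rewrite WE !expr2; apply: eqmodM; [apply: eqmodM|]; apply: EB.
pose N d := poch (- q ^+ d) (q ^+ d) n.
have BN d : B d * N d = B (d * 2)%N by rewrite /B /N poch_sq -!exprM.
have hW : eqmod (q ^+ M) (hproduct q n * W) 1.
  apply: (eqmod_cancel (Einv 2 isT)); apply: (eqmod_cancel (Einv 8 isT)).
  apply: (eqmod_cancel (Einv 8 isT)).
  have -> : B 8 * (B 8 * (B 2 * (hproduct q n * W))) =
     hproduct q n * (W * B 2 * B 8 ^+ 2) by ring.
  apply: eqmod_trans (eqmodMl _ WB) _.
  rewrite /hproduct psi_productE -/(B 4) -/(N 4).
  have -> : poch (- q) q n = N 1 by rewrite /N expr1.
  have -> : N 1 * invqpoch q M n * (B 4 * N 4 ^+ 2) * (B 1 ^+ 2 * B 4) =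
     (B 1 * invqpoch q M n) * ((B 1 * N 1) * (B 4 * N 4) ^+ 2) by ring.
  rewrite !BN -[X in eqmod _ _ X]mul1r; apply: eqmodM.
    by rewrite /B expr1; apply: invqpochP.
  by apply: eqmod_eq; ring.
apply: eqmod_trans (_ : eqmod _ (hproduct q n * (W * G)) _).
  by rewrite -[X in eqmod _ X]mulr1; apply/eqmodMl/eqmod_sym.
by rewrite mulrA -[X in eqmod _ _ X]mul1r; apply: eqmodMr.
Qed.

End ColouredProduct.

Lemma ncolours_le2 m : (ncolours m <= 2)%N.
Proof. by rewrite /ncolours; do !case: ifP. Qed.

(** One geometric sum per pair of part and colour; expanding their product chooses a multiplicity
    for each pair, that is, a function [f]. *)
Lemma coloured_genfun n :
  (\prod_(1 <= m < n.+1) geomT n m ^+ ncolours m)`_n = (count_coloured n)%:Z.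
Proof.
pose T := ('I_n.+1 * 'I_2)%type.
pose ok (p : T) (i : 'I_n.+1) :=
  (i != 0 :> nat) ==> ((0 < p.1)%N && (p.2 < ncolours p.1)%N).
have -> : \prod_(1 <= m < n.+1) geomT n m ^+ ncolours m =
    \prod_(p : T) \sum_(i | ok p i) 'X^(p.1 * i) :> {poly int}.
  rewrite -(pair_bigA _ (fun m c => \sum_(i | ok (m, c) i) 'X^(m * i))) /=.
  rewrite big_ord_recl big_add1 big_mkord /=.
  (* A forbidden pair admits only multiplicity 0 and contributes the factor 1. *)
  have sum0 (p : T) : ~~ ((0 < p.1)%N && (p.2 < ncolours p.1)%N) ->
      \sum_(i | ok p i) 'X^(p.1 * i) = 1 :> {poly int}.
    move=> /negbTE np; rewrite (big_pred1 ord0) ?muln0 // => i.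
    by rewrite /ok np implybF negbK.
  rewrite [X in X * _]big1 => [|c _]; last by rewrite sum0.
  rewrite mul1r; apply: eq_bigr => m _.
  have sum1 (c : 'I_2) : (c < ncolours m.+1)%N ->
      \sum_(i | ok (lift ord0 m, c) i) 'X^(lift ord0 m * i) = geomT n m.+1.
    by move=> cm; apply: eq_bigl => i; rewrite /ok /= cm implybT.
  rewrite big_ord_recl big_ord1.
  have := ncolours_le2 m.+1; case nc: (ncolours m.+1) => [|[|[|//]]] _.
  - by rewrite !sum0 /= ?nc // mulr1.
  - by rewrite sum1 ?nc // sum0 /= ?nc // mulr1.
  - by rewrite !sum1 ?nc.
rewrite bigA_distr_big_dep /= coef_sum.
under eq_bigr => f _ do rewrite prodrXr coefXn.
rewrite -natr_sum natz; congr Posz.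
rewrite /count_coloured -sum1_card big_mkcond [RHS]big_mkcond.
apply: eq_bigr => f _; rewrite inE /coloured_partition.
have -> : (f \in family ok) = [forall p : T,
    (f p != 0 :> nat) ==> ((0 < p.1)%N && (p.2 < ncolours p.1)%N)].
  by apply/familyP/forallP.
by case: [forall _, _] => //=; rewrite eq_sym; case: eqP.
Qed.

Theorem theorem3 (n : nat) :
  h n = hprod n /\ h n = (count_coloured n)%:Z.
Proof.
have hh : h n = hprod n by rewrite hE coef_hsum_hproduct -hprodE.
split=> //; rewrite hh hprodE -coloured_genfun.
by have /eqmod_coefP := hproduct_colours ('X : {poly int}) n; apply.
Qed.
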